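(* Let $L$ be a locally finite Lie algebra over a field of characteristic zero. Suppose $L$ has a representation $R=(M,L)$ in a vector space $M$ such that for every $x\in L$ the linear transformation $x^R$ has Fitting null component of finite codimension in $M$, and such that the associative span $\mathcal{A}$ of $L$ in the representation $R$ is locally finite. If the kernel of the representation $R$ is locally solvable and $\operatorname{tr}\big((x^R)^2\big)=0$ for every $x\in L'$, then $L$ is locally solvable.
   Context: Vector spaces may be infinite-dimensional; linear transformations are written on the right. A (Lie or associative) algebra is locally finite if every finite subset is contained in a finite-dimensional subalgebra. A Lie algebra is locally solvable if every finite subset is contained in a solvable subalgebra (for locally finite Lie algebras: every finite-dimensional subalgebra is solvable). $L'=[L,L]$. A representation $R=(M,L)$ is a homomorphism $x\mapsto x^R$ of the Lie algebra $L$ into the Lie algebra of linear transformations of the vector space $M$ (with commutator bracket). The associative span $\mathcal{A}$ of $L$ in $R$ is the associative algebra of linear transformations of $M$ generated by all $x^R$, $x\in L$. The Fitting null component of a linear transformation $A$ of $M$ is $M_{0A}=\{y\in M : yA^m=0 \text{ for some positive integer } m\}$. If $M_{0A}$ has finite codimension in $M$, the trace $\operatorname{tr}A$ is defined as the trace of the linear transformation induced by $A$ in the finite-dimensional space $M/M_{0A}$. (The transformations $x^R$ and $(x^R)^2$ have the same Fitting null component.) *)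

(* Defs.v *)
From HB Require Import structures.
From mathcomp Require Import all_boot all_order all_algebra.
From mathcomp Require Import boolp classical_sets functions cardinality.

Set Implicit Arguments.
Unset Strict Implicit.
Unset Printing Implicit Defensive.

Import GRing.Theory.
Local Open Scope classical_set_scope.
Local Open Scope ring_scope.

HB.mixin Record Lmodule_isLieAlgebra (F : fieldType) L of GRing.Lmodule F L := {
  lie_bracket : L -> L -> L;
  lie_bracket_linearl : forall y : L, linear (lie_bracket^~ y);
  lie_bracket_linearr : forall x : L, linear (lie_bracket x);
  lie_bracket_alt : forall x : L, lie_bracket x x = 0;
  lie_bracket_jacobi : forall x y z : L,
    lie_bracket x (lie_bracket y z) + lie_bracket y (lie_bracket z x)
    + lie_bracket z (lie_bracket x y) = 0
}.

#[short(type="lieAlgType")]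
HB.structure Definition LieAlgebra (F : fieldType) :=
  {L of GRing.Lmodule F L & Lmodule_isLieAlgebra F L}.

Definition linear_subspace (F : fieldType) (V : lmodType F) (A : set V) : Prop :=
  submod_closed [in A].

Definition lspan (F : fieldType) (V : lmodType F) (X : set V) : set V :=
  smallest (@linear_subspace F V) X.

Definition finite_dim (F : fieldType) (V : lmodType F) (A : set V) : Prop :=
  exists2 S : set V, finite_set S & A = lspan S.

(* Every finite subset of [A] lies in some [B] included in [A] such that
   [P B]; taking for [P] a class of subalgebras yields the local properties. *)
Definition locally_in (T : Type) (P : set T -> Prop) (A : set T) : Prop :=
  forall S : set T, finite_set S -> S `<=` A ->
    exists B : set T, [/\ P B, S `<=` B & B `<=` A].

Section Lie.
Variables (F : fieldType) (L : lieAlgType F).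
Implicit Types A B : set L.

Definition lie_subalgebra A : Prop :=
  linear_subspace A /\ forall x y, A x -> A y -> A (lie_bracket x y).

Definition lie_prod A B : set L :=
  lspan [set lie_bracket x y | x in A & y in B].

Definition derived_algebra : set L := lie_prod setT setT.

Fixpoint lie_derived_series A (n : nat) : set L :=
  if n is m.+1 then lie_prod (lie_derived_series A m) (lie_derived_series A m)
  else A.

Definition lie_solvable A : Prop := exists n, lie_derived_series A n `<=` [set 0].

Definition lie_locally_finite : set L -> Prop :=
  locally_in (fun B => lie_subalgebra B /\ finite_dim B).

Definition lie_locally_solvable : set L -> Prop :=
  locally_in (fun B => lie_subalgebra B /\ lie_solvable B).

End Lie.

(* Linear transformations of [M] are written on the right: the product of [A]
   and [B] is [A \; B], which maps [v] to [B (A v)].  They are elements of the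
   vector space [M -> M] of all functions, under pointwise operations. *)
Section Transformations.
Variables (F : fieldType) (M : lmodType F).
Implicit Types (A : M -> M) (N : set M).

(* not necessarily containing the identity *)
Definition assoc_subalgebra (B : set (M -> M)) : Prop :=
  linear_subspace B /\ forall A1 A2, B A1 -> B A2 -> B (A1 \; A2).

Definition assoc_locally_finite : set (M -> M) -> Prop :=
  locally_in (fun B => assoc_subalgebra B /\ finite_dim B).

Definition fitting_null A : set M :=
  [set y | exists2 m : nat, (0 < m)%N & iter m A y = 0].

(* The cosets of the vectors [e i] form a basis of [M / N]. *)
Definition coset_basis N (n : nat) (e : 'I_n -> M) : Prop :=
  forall v : M, exists! c : 'rV[F]_n, N (v - \sum_i c 0 i *: e i).

Definition finite_codim N : Prop :=
  exists (n : nat) (e : 'I_n -> M), coset_basis N e.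

(* [P] is the matrix, acting on row vectors, of the transformation of [M / N]
   induced by [A], in the basis of the cosets of the [e i]. *)
Definition induced_mx N A (n : nat) (e : 'I_n -> M) (P : 'M[F]_n) : Prop :=
  forall i, N (A (e i) - \sum_j P i j *: e j).

(* Trace of the transformation induced by [A] in [M / fitting_null A], computed
   in any basis; it does not depend on the choice of [e] when [A] is linear.  It
   is the junk value 0 if [fitting_null A] does not have finite codimension. *)
Definition fitting_trace A : F :=
  xget 0 [set t | exists (n : nat) (e : 'I_n -> M) (P : 'M[F]_n),
    [/\ coset_basis (fitting_null A) e, induced_mx (fitting_null A) A e P
      & t = \tr P]].

End Transformations.

Section Representations.
Variables (F : fieldType) (L : lieAlgType F) (M : lmodType F).
Variable rho : {linear L -> (M -> M)}.

Definition lie_representation : Prop :=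
  (forall x, linear (rho x)) /\
  (forall x y, rho (lie_bracket x y) = (rho x \; rho y) - (rho y \; rho x)).

Definition rep_kernel : set L := [set x | rho x = 0].

Definition assoc_span : set (M -> M) :=
  smallest (@assoc_subalgebra F M) (range rho).

End Representations.

(* Main.v *)
From HB Require Import structures.
Require Import Defs.
From mathcomp Require Import all_boot all_order all_algebra fieldext.
From mathcomp Require Import boolp classical_sets functions cardinality.
From mathcomp Require Import ring.
Set Implicit Arguments.
Unset Strict Implicit.
Unset Printing Implicit Defensive.
Import GRing.Theory.
Local Open Scope classical_set_scope.
Local Open Scope ring_scope.

(** The local hypotheses reduce the statement to Cartan's criterion for
    finite-dimensional Lie algebras of matrices.

    Every finite subset of [L] lies in a finite-dimensional subalgebra [H], and
    [H] has to be shown solvable.  The transformations [rho x], [x] in [H], lie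
    in a finite-dimensional associative algebra, so every finite set of vectors
    lies in a finite-dimensional [H]-invariant subspace [W] of [M]
    ([finite_invariant_subspace]).  Two finite sets of vectors are forced into
    [W].  The first makes [W] faithful, in the sense that an element of [H] that
    kills [W] lies in the kernel of [rho] ([finite_faithful_witness]).  The
    second contains representatives of [M] modulo the Fitting null component of
    [rho x]; then [W] maps onto that quotient with a kernel on which [rho x] is
    nilpotent, so the trace of [(rho x)^2] on [W] is its Fitting trace
    ([fitting_trace_invariant]).  This second requirement can be met for finitely
    many [x] only, but finitely many suffice: the form tr (xy) on [H' = [H, H]]
    vanishes as soon as its quadratic form vanishes at the vectors of a finite
    generating family and at their pairwise sums.  So the trace form of the
    matrices of [H'] on [W] is zero.

    From there on the argument is about matrices.  If a Lie algebra [K] of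
    matrices in characteristic zero has zero trace form, then every [x] in
    [[K, K]] is nilpotent ([cartan_trace_nilpotent]).  Over a splitting field
    write [e_a] for the projection onto the generalized eigenspace of [x] at
    [a].  Give the eigenvalues rational weights [w_a] that are orthogonal to all
    rational linear relations between the eigenvalues; then [w_b - w_a] depends
    on [b - a] alone.  Let [Y] be the sum of the [w_a e_a].  The commutator with
    [Y] multiplies [e_a v e_b] by [w_b - w_a], hence is a polynomial in the
    commutator with [x] and maps [K] into its span; so
    tr ([u,v] Y) = tr (u [v,Y]) = 0 for [u], [v] in [K], and tr (x Y) = 0
    ([mxtrace_commutator_projections]).  With [m_a] the multiplicity of [a], the
    sum of the [m_a w_a a] is thus zero, which makes [(m_a w_a)] a rational
    relation.  As [w] is orthogonal to it, the sum of the [m_a w_a^2] is zero, and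
    [w = 0].  No nonzero weight being orthogonal to the relations, everything is a
    relation, and every eigenvalue is zero ([rational_duality_eq0]).

    By Engel's theorem ([engel]) all long products of matrices of [[H', H']]
    vanish, so some term of the derived series of [H] acts by zero on [W]
    ([repmx_derived_series]) and thus lies in the kernel of [rho].  It is
    finite-dimensional, and the kernel is locally solvable, so it is solvable;
    hence so is [H]. *)

(** * Linear maps and iteration *)

Definition linear_map_of (F : fieldType) (M : lmodType F) (f : M -> M)
    (f_lin : linear f) :
  {linear M -> M} := HB.pack f (GRing.isLinear.Build F M M _ f f_lin).

Section IterLinear.
Variables (F : fieldType) (V : lmodType F) (T : {linear V -> V}).

Lemma iter_linear i : linear (iter i T).
Proof. by elim: i => // i IHi a u v; rewrite !iterS IHi linearP. Qed.

End IterLinear.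

(** * Ranks and traces of matrices *)

Lemma max_rank_mx (F : fieldType) p (P : set 'M[F]_p) :
  P !=set0 -> exists2 T, P T & forall T', P T' -> (\rank T' <= \rank T)%N.
Proof.
move=> [T0 PT0].
pose Q k := `[< exists2 T, P T & \rank T = k >].
have exQ : exists k, Q k by exists (\rank T0); apply/asboolP; exists T0.
have Qle k : Q k -> (k <= p)%N by move=> /asboolP[T _ <-]; apply: rank_leq_row.
case: (ex_maxnP exQ Qle) => k /asboolP[T PT <-] max; exists T => // T' PT'.
by apply: max; apply/asboolP; exists T'.
Qed.

(** A matrix of maximal rank among those with row space inside [P] works: adding
    to it a further vector of [P] cannot raise the rank. *)
Lemma subspace_row_space (F : fieldType) p (P : set 'rV[F]_p) :
  P 0 -> (forall a u v, P u -> P v -> P (a *: u + v)) ->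
  exists T : 'M[F]_p, forall v, P v <-> (v <= T)%MS.
Proof.
move=> P0 Plin.
pose inP (T : 'M[F]_p) := forall v, (v <= T)%MS -> P v.
have [|T PT maxT] := @max_rank_mx F p inP.
  by exists 0 => v; rewrite submx0 => /eqP->.
exists T => v; split=> [Pv|]; last exact: PT.
have PTv : inP (T + v)%MS.
  move=> u /sub_addsmxP[[c1 c2] ->] /=.
  rewrite addrC [c2]mx11_scalar mul_scalar_mx.
  by apply: Plin => //; apply: PT; apply: submxMl.
have := maxT _ PTv; rewrite (geq_leqif (mxrank_leqif_sup (addsmxSl T v))) => leTv.
exact: submx_trans (addsmxSr T v) leTv.
Qed.

Lemma mulmx_expS (R : pzRingType) m n (C : 'M[R]_(m, n)) (D : 'M[R]_(n, m)) j :
  (C *m D) ^+ j.+1 = C *m (D *m C) ^+ j *m D.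
Proof.
elim: j => [|j IHj]; first by rewrite expr1 expr0 mulmx1.
by rewrite exprSr IHj [in RHS]exprSr -!mulmxE !mulmxA.
Qed.

(** With a rank factorization [A = C *m D] one has [\tr A = \tr (D *m C)], and
    [D *m C] is again nilpotent.  It is a smaller matrix, because a nilpotent
    matrix of positive size is singular; hence an induction on the size, with no
    recourse to eigenvalues. *)
Lemma mxtrace_nilpotent (F : fieldType) n (A : 'M[F]_n) k :
  A ^+ k = 0 -> \tr A = 0.
Proof.
elim/ltn_ind: n A k => n IHn A k Ak0.
have [ltAn | leAn] := ltnP (\rank A) n; last first.
  case: n => [|n] in A Ak0 leAn IHn *; first by rewrite (flatmx0 A) raddf0.
  have uA : A \in unitmx by rewrite -row_full_unit -col_leq_rank.
  suff: A ^+ k \in unitmx by rewrite Ak0 unitmxE det0 unitr0.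
  by rewrite (unitrX k uA).
rewrite -{1}(mulmx_base A) mxtrace_mulC; apply: (IHn _ ltAn _ k.+1).
rewrite mulmx_expS.
have -> : (col_base A *m row_base A) ^+ k = 0 by rewrite mulmx_base.
by rewrite mulmx0 mul0mx.
Qed.

(** Cancel [C] on the left and [D] on the right. *)
Lemma mulmx_base_idempotent (F : fieldType) n r (C : 'M[F]_(n, r)) (D : 'M[F]_(r, n)) :
  row_full C -> row_free D -> C *m D *m (C *m D) = C *m D -> D *m C = 1%:M.
Proof.
move=> /row_fullP[C' C'C] /row_freeP[D' DD'] /(congr1 (fun A => C' *m A *m D')).
by rewrite /= !mulmxA C'C !mul1mx -!mulmxA DD' !mulmx1.
Qed.

(** A full-rank factorization [e = C *m D] of an idempotent has [D *m C = 1]. *)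
Lemma mxtrace_idempotent (F : fieldType) n (e : 'M[F]_n) :
  e *m e = e -> \tr e = (\rank e)%:R.
Proof.
move=> ee; rewrite -{1}(mulmx_base e) mxtrace_mulC mulmx_base_idempotent ?mxtrace1 //.
- exact: col_base_full.
- exact: row_base_free.
- by rewrite mulmx_base.
Qed.

(** * Engel's theorem for Lie algebras of nilpotent matrices *)

Section Engel.
Variables (F : fieldType) (n : nat).
Implicit Types (S T : set 'M[F]_n) (A B x y t v : 'M[F]_n) (w : seq 'M[F]_n).

(** The associative algebra without unit generated by [T] is nilpotent, of index
    at most [k]. *)
Definition words_vanish T k : Prop :=
  forall w, (forall t, t \in w -> T t) -> size w = k -> \prod_(t <- w) t = 0.

(** These sets form an ascending flag as [j] grows; for row vectors in place of
    matrices it would be the flag in which [T] is strictly triangular. *)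
Fixpoint annihilated_by_words T (j : nat) v : Prop :=
  if j is i.+1 then forall t, T t -> annihilated_by_words T i (v * t) else v = 0.
Local Notation U := annihilated_by_words.

Lemma annihilated_lin T j a u v : U T j u -> U T j v -> U T j (a *: u + v).
Proof.
elim: j u v => [|j IHj] u v /=; first by move=> -> ->; rewrite scaler0 addr0.
move=> Uu Uv t Tt; rewrite mulrDl -mulmxE -scalemxAl.
by apply: IHj; [apply: Uu | apply: Uv].
Qed.

Lemma annihilated0 T j : U T j 0.
Proof. by elim: j => //= j IHj t _; rewrite mul0r. Qed.

Lemma annihilatedM T j v t : T t -> U T j v -> U T j (v * t).
Proof.
elim: j v t => [|j IHj] v t Tt /=; first by move=> ->; rewrite mul0r.
by move=> Uv t' Tt'; apply: IHj => //; apply: Uv.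
Qed.

Lemma words_vanish_annihilated T k v : words_vanish T k -> U T k v.
Proof.
suff U_words j u : (forall w, (forall t, t \in w -> T t) -> size w = j ->
    u * \prod_(t <- w) t = 0) -> U T j u.
  by move=> Tk; apply: U_words => w Tw sz_w; rewrite (Tk w) ?mulr0.
elim: j u => [|j IHj] u /= uw.
  by have := uw [::]; rewrite big_nil mulr1; apply.
move=> t Tt; apply: IHj => w Tw sz_w.
have := uw (t :: w); rewrite big_cons mulrA; apply; last by rewrite /= sz_w.
by move=> t'; rewrite inE => /predU1P[->|/Tw].
Qed.

Section Extend.
Variables (T : set 'M[F]_n) (x : 'M[F]_n).
Hypothesis normT : forall t, T t -> T (x * t - t * x).

(** Since [v x t = (v t) x + v (x t - t x)], moving [x] to the right across a word
    of [T] leaves only words of [T] of the same length. *)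
Lemma annihilated_normaliser j v : U T j v -> U T j (v * x).
Proof.
elim: j v => [|j IHj] v /=; first by move=> ->; rewrite mul0r.
move=> Uv t Tt.
have -> : v * x * t = (1 : F) *: (v * t * x) + v * (x * t - t * x).
  by rewrite scale1r mulrBr !mulrA addrC subrK.
by apply: annihilated_lin; [apply/IHj/Uv | apply/Uv/normT].
Qed.

Definition line_extension : set 'M[F]_n :=
  [set A | exists2 t, T t & exists c, A = t + c *: x].

Lemma annihilated_extension_prod j v w :
  (forall A, A \in w -> line_extension A) ->
  U T j v -> U T j (v * \prod_(A <- w) A).
Proof.
elim: w v => [|A w IHw] v Tw Uv; first by rewrite big_nil mulr1.
rewrite big_cons mulrA; apply: IHw => [B Bw|]; first by apply: Tw; rewrite inE Bw orbT.
have [t Tt [c ->]] := Tw A (mem_head _ _).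
rewrite mulrDr addrC -mulmxE -scalemxAr.
by apply: annihilated_lin; [apply: annihilated_normaliser | apply: annihilatedM].
Qed.

(** Modulo the lower step of the flag, [T] acts by zero, so [t + c x] acts there as
    [c x] does. *)
Lemma annihilated_extension_power j v w :
    (forall A, A \in w -> line_extension A) -> U T j.+1 v ->
  exists c, U T j (v * \prod_(A <- w) A - c *: (v * x ^+ size w)).
Proof.
elim: w v => [|A w IHw] v Tw Uv.
  by exists 1; rewrite big_nil /= expr0 scale1r subrr; apply: annihilated0.
have Tw' B : B \in w -> line_extension B by move=> Bw; apply: Tw; rewrite inE Bw orbT.
have [t Tt [c ->]] := Tw A (mem_head _ _).
have [d Ud] := IHw (v * x) Tw' (annihilated_normaliser Uv).
exists (c * d); rewrite big_cons /= exprS -scalerA.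
have -> : v * ((t + c *: x) * \prod_(j0 <- w) j0) - c *: (d *: (v * (x * x ^+ size w)))
  = c *: (v * x * \prod_(B <- w) B - d *: (v * x * x ^+ size w))
    + v * t * \prod_(B <- w) B.
  rewrite mulrDl mulrDr scalerBr -addrA addrC; congr (_ - _ + _); last by rewrite mulrA.
    by rewrite -!mulmxE -!scalemxAl -!scalemxAr mulmxA.
  by rewrite mulrA.
by apply: annihilated_lin => //; apply: annihilated_extension_prod => //; apply: Uv.
Qed.

(** The nilpotency of [x] makes each block of [m] factors descend one step of the
    flag, which has [k] steps. *)
Lemma words_vanish_extension k m :
  words_vanish T k -> x ^+ m = 0 -> words_vanish line_extension (m * k).
Proof.
move=> Tk xm0.
suff Uw j v w : U T j v -> (forall A, A \in w -> line_extension A) ->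
    size w = (m * j)%N -> v * \prod_(A <- w) A = 0.
  move=> w Tw sz_w; rewrite -[LHS]mul1r (Uw k) //.
  exact: words_vanish_annihilated.
elim: j v w => [|j IHj] v w; first by move=> /= ->; rewrite mul0r.
move=> Uv Tw sz_w; rewrite -(cat_take_drop m w) big_cat mulrA /=.
apply: IHj => [|A /mem_drop/Tw //|]; last first.
  by rewrite size_drop sz_w mulnS addKn.
have Tw' A : A \in take m w -> line_extension A by move/mem_take/Tw.
have [c] := annihilated_extension_power Tw' Uv.
rewrite size_takel ?sz_w ?mulnS ?leq_addr // xm0 mulr0 scaler0 subr0 //.
Qed.
End Extend.

(** A bookkeeping device for the [m]-fold commutators of [z] with elements of [T]:
    such a commutator is a sum of products [u z v] of [m] letters of [T] around
    [z], and becomes zero once some side must have [k] letters. *)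
Definition sandwiched_zero T k m (z : 'M[F]_n) : Prop :=
  forall u v : seq 'M[F]_n, (forall t, t \in u -> T t) -> (forall t, t \in v -> T t) ->
    (k.*2 <= size u + size v + m)%N ->
    \prod_(t <- u) t * z * \prod_(t <- v) t = 0.

Lemma words_vanish_ge T k w :
    words_vanish T k -> (forall t, t \in w -> T t) -> (k <= size w)%N ->
  \prod_(t <- w) t = 0.
Proof.
move=> Tk Tw lekw; rewrite -(cat_take_drop k w) big_cat /= Tk ?mul0r //.
  by move=> t /mem_take/Tw.
exact: size_takel.
Qed.

Lemma words_vanish_sandwiched T k z : words_vanish T k -> sandwiched_zero T k 0 z.
Proof.
move=> Tk u v Tu Tv; rewrite addn0 => le2k.
have [leku | ltuk] := leqP k (size u); first by rewrite (words_vanish_ge Tk) ?mul0r.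
rewrite (words_vanish_ge (w := v) Tk) ?mulr0 //.
rewrite -(leq_add2l k) addnn; apply: leq_trans le2k _.
by rewrite leq_add2r ltnW.
Qed.

Lemma sandwiched_commutator T k m z t :
  T t -> sandwiched_zero T k m z -> sandwiched_zero T k m.+1 (z * t - t * z).
Proof.
move=> Tt zm u v Tu Tv; rewrite addnS -addSn => leuvm.
rewrite mulrBr mulrBl.
have -> : \prod_(a <- u) a * (z * t) * \prod_(a <- v) a = 0.
  have := zm u (t :: v) Tu; rewrite big_cons !mulrA; apply; last first.
    by rewrite /= addnS.
  by move=> a; rewrite inE => /predU1P[->|/Tv].
have -> : \prod_(a <- u) a * (t * z) * \prod_(a <- v) a = 0.
  have := zm (rcons u t) v; rewrite -cats1 big_cat big_seq1 !mulrA.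
  apply=> //; last by rewrite size_cat addn1.
  by move=> a; rewrite mem_cat inE => /orP[/Tu|/eqP->].
by rewrite subr0.
Qed.

(** Otherwise any element of [S] outside [T] has a commutator with [T] that is
    again outside [T], and iterating gives nonzero commutators of every length,
    whereas those of length [2 k] vanish. *)
Lemma exists_normalising S T k :
    T 0 ->
    (forall x y, S x -> S y -> S (x * y - y * x)) -> T `<=` S ->
    words_vanish T k -> ~ (S `<=` T) ->
  exists x, [/\ S x, ~ T x & forall t, T t -> T (x * t - t * x)].
Proof.
move=> T0 Sbr TS Tk /existsNP[y0 /not_implyP[Sy0 nTy0]].
apply: contrapT => noX.
have descend m : exists y, [/\ S y, ~ T y & sandwiched_zero T k m y].
  elim: m => [|m [y [Sy nTy ym]]].
    by exists y0; split=> //; apply: words_vanish_sandwiched.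
  have /existsNP[t /not_implyP[Tt nTyt]] : ~ forall t, T t -> T (y * t - t * y).
    by move=> normy; apply: noX; exists y.
  exists (y * t - t * y); split=> //; first exact: Sbr (Sy) (TS _ Tt).
  exact: sandwiched_commutator.
have [y [_ nTy y2k]] := descend k.*2; apply: nTy.
have := y2k [::] [::]; rewrite !big_nil mul1r mulr1 => -> //=.
Qed.

(** Among the Lie subalgebras of [S] whose long words vanish, take one of maximal
    dimension.  If it were proper, a normalising [x] outside it would extend it by
    a line, again with vanishing long words. *)
Theorem engel S :
    S 0 -> (forall a x y, S x -> S y -> S (a *: x + y)) ->
    (forall x y, S x -> S y -> S (x * y - y * x)) ->
    (forall x, S x -> exists m, x ^+ m = 0) ->
  exists k, words_vanish S k.
Proof.
move=> S0 Slin Sbr Snil.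
pose good (Q : 'M[F]_(n * n)) := let T := [set A | (A \in Q)%MS] in
  [/\ T `<=` S, forall x y, T x -> T y -> T (x * y - y * x) & exists k, words_vanish T k].
have [|Q [QS Qbr [k Qk]] maxQ] := @max_rank_mx F _ good.
  exists 0; have T0 (A : 'M[F]_n) : (A \in (0 : 'M[F]_(n * n)))%MS -> A = 0.
    by rewrite submx0 mxvec_eq0 => /eqP.
  split=> [A /T0-> //|x y /T0-> /T0->|]; first by rewrite /= mul0r subrr linear0 sub0mx.
  exists 1%N => -[|A [|]] //= TA _; rewrite big_seq1.
  by apply/T0/TA/mem_head.
pose T := [set A | (A \in Q)%MS].
suff ST : S `<=` T by exists k => w Sw; apply: Qk => t /Sw/ST.
apply: contrapT => nST.
have Tlin a x y : T x -> T y -> T (a *: x + y).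
  by rewrite /T /= => Tx Ty; rewrite linearP addmx_sub // scalemx_sub.
have T0 : T 0 by rewrite /T /= linear0 sub0mx.
have [x [Sx nTx normx]] := exists_normalising T0 Sbr QS Qk nST.
have [m xm0] := Snil x Sx.
pose Q' := (Q + mxvec x)%MS.
have Q'E A : (A \in Q')%MS -> line_extension T x A.
  move=> /sub_addsmxP[[c1 c2] /= AE]; exists (vec_mx (c1 *m Q)).
    by rewrite /T /= vec_mxK submxMl.
  exists (c2 0 0); rewrite -[LHS]mxvecK AE linearD /= {1}[c2]mx11_scalar mul_scalar_mx.
  by rewrite linearZ /= mxvecK.
have extE A : line_extension T x A -> (A \in Q')%MS.
  move=> [t Tt [c ->]]; rewrite linearD linearZ /= addmx_sub //.
    exact: submx_trans Tt (addsmxSl _ _).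
  by rewrite scalemx_sub // addsmxSr.
apply: nTx; rewrite /T /=.
suff /maxQ : good Q'.
  rewrite (geq_leqif (mxrank_leqif_sup (addsmxSl Q (mxvec x)))).
  exact/submx_trans/addsmxSr.
split=> [A /Q'E[t Tt [c ->]]|A B /Q'E[s Ts [c ->]] /Q'E[t Tt [d ->]]|].
- by rewrite addrC; apply: Slin => //; apply: QS.
- apply: extE.
  exists (c *: (x * t - t * x) + ((- d) *: (x * s - s * x) + (s * t - t * s))).
    by apply: (Tlin); [apply: normx | apply: Tlin; [apply: normx | apply: Qbr]].
  exists 0; rewrite scale0r addr0 !mulrDl !mulrDr -!mulmxE.
  rewrite -?scalemxAl -?scalemxAr -?scalemxAl.
  move: (s *m t) (t *m s) (x *m t) (t *m x) (x *m s) (s *m x) (x *m x).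
  move=> a1 a2 a3 a4 a5 a6 a7.
  by apply/matrixP => i j; rewrite !mxE; ring.
- exists (m * k)%N; have Ek := words_vanish_extension normx Qk xm0.
  by move=> w Q'w; apply: Ek => A /Q'w/Q'E.
Qed.
End Engel.

(** * Splitting fields and polynomial interpolation *)

Lemma exists_irreducible_factor (F : fieldType) (p : {poly F}) :
  (1 < size p)%N -> exists2 q, irreducible_poly q & q %| p.
Proof.
move=> p_gt1; have p0 : p != 0 by rewrite -size_poly_gt0 ltnW.
pose Q k := `[< exists q : {poly F}, [/\ q %| p, (1 < size q)%N & size q = k] >].
have exQ : exists k, Q k by exists (size p); apply/asboolP; exists p; split.
case: (ex_minnP exQ) => k /asboolP[q [qp q_gt1 <-]] min_q.
exists q => //; split=> // d d1 dq.
have q0 : q != 0 by rewrite -size_poly_gt0 ltnW.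
rewrite -(dvdp_size_eqp dq) eqn_leq dvdp_leq //=.
apply: min_q; apply/asboolP; exists d; split=> //; first exact: dvdp_trans dq qp.
rewrite ltn_neqAle eq_sym d1 size_poly_gt0.
by apply: contraNneq q0 => d0; rewrite d0 dvd0p in dq.
Qed.

(** Adjoin a root of an irreducible factor, divide it out, and repeat. *)
Lemma exists_splitting_field (F : fieldType) (p : {poly F}) : p != 0 ->
  exists (E : fieldType) (f : {rmorphism F -> E}) (s : seq E),
    map_poly f p %= \prod_(a <- s) ('X - a%:P).
Proof.
have [k] := ubnP (size p).
elim: k => // k IHk in F p * => lepk p0.
have [p1|p1] := leqP (size p) 1.
  exists F, idfun, [::]; rewrite big_nil map_poly_id // -size_poly_eq1.
  by rewrite eqn_leq p1 size_poly_gt0.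
have [q irr_q qp] := exists_irreducible_factor p1.
have [L _ [z qz _]] := irredp_FAdjoin irr_q.
have pz : root (map_poly (in_alg L) p) z.
  by move: qz; rewrite -!dvdp_XsubCl => qz; apply: (dvdp_trans qz); rewrite dvdp_map.
have [p' defp] := factor_theorem _ _ pz.
have p'0 : p' != 0.
  by apply: contraNneq p0 => p'0; rewrite -(map_poly_eq0 (in_alg L)) defp p'0 mul0r.
have [|E [f [s fs]]] := IHk L p' _ p'0.
  rewrite -(size_map_poly (in_alg L)) defp size_Mmonic ?monicXsubC // size_XsubC in lepk.
  by rewrite addn2 in lepk.
exists E, (f \o in_alg L), (f z :: s).
rewrite (map_poly_comp f (in_alg L)) defp rmorphM /= map_polyXsubC big_cons mulrC.
exact: eqp_mull.
Qed.

Section CRT.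
Variables (E : fieldType) (N : nat).
Local Notation P a := (('X - a%:P) ^+ N : {poly E}).

Lemma coprimep_XsubC_prod a (r : seq E) : a \notin r ->
  coprimep (P a) (\prod_(b <- r) P b).
Proof.
move=> anr; rewrite big_seq; apply: (big_ind (coprimep _)) => [|p q cp cq|b br].
- exact: coprimep1.
- by rewrite coprimepMr cp.
apply/coprimep_expl/coprimep_expr.
by rewrite coprimep_XsubC root_XsubC; apply: contraNneq anr => <-.
Qed.

Lemma prod_XsubC_dvd r p : uniq r -> (forall a, a \in r -> P a %| p) ->
  \prod_(a <- r) P a %| p.
Proof.
elim: r => [|a r IHr] /=; first by rewrite big_nil dvd1p.
move=> /andP[anr ur] rp; rewrite big_cons Gauss_dvdp ?coprimep_XsubC_prod //.
by rewrite rp ?mem_head ?IHr // => b br; rewrite rp // inE br orbT.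
Qed.

(** The Chinese remainder theorem for the pairwise coprime powers
    [('X - a) ^+ N], one modulus at a time. *)
Lemma poly_interpolation r (g : E -> E) : uniq r ->
  exists p, forall a, a \in r -> P a %| p - (g a)%:P.
Proof.
elim: r => [|a r IHr] /=; first by exists 0.
move=> /andP[anr /IHr[p rp]].
have /Bezout_eq1_coprimepP[[u v] /= uv1] := coprimep_XsubC_prod anr.
exists (p * (u * P a) + (g a)%:P * (v * \prod_(b <- r) P b)) => b.
rewrite inE => /predU1P[->|br].
  have -> : v * \prod_(b <- r) P b = 1 - u * P a.
    by apply/eqP; rewrite eq_sym subr_eq addrC uv1.
  have -> : p * (u * P a) + (g a)%:P * (1 - u * P a) - (g a)%:P
    = (p * u - (g a)%:P * u) * P a by ring.
  exact: dvdp_mull.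
have -> : p * (u * P a) + (g a)%:P * (v * \prod_(b0 <- r) P b0) - (g b)%:P =
   (p - (g b)%:P) + ((g a)%:P - p) * v * \prod_(b0 <- r) P b0.
  have -> : u * P a = 1 - v * \prod_(b <- r) P b by apply/eqP; rewrite eq_sym subr_eq uv1.
  ring.
rewrite dvdp_add ?rp // dvdp_mull // (big_rem b) //= dvdp_mulr //.
Qed.
End CRT.

Section Decomposition.
Variables (E : fieldType) (n : nat) (X : 'M[E]_n.+1).

(** The projections onto the generalized eigenspaces.  [e a] is the value at [X] of
    a polynomial congruent to 1 modulo [('X - a) ^+ N] and to 0 modulo the powers
    at the other roots.  Since [N] is at least every multiplicity, a polynomial
    divisible by all these powers is divisible by the product that kills [X], so
    each stated identity can be checked modulo one power at a time.  Roots with a zero projection are dropped. *)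
Lemma spectral_projections (s : seq E) :
    horner_mx X (\prod_(a <- s) ('X - a%:P)) = 0 ->
  exists (r : seq E) (N : nat) (e : E -> 'M[E]_n.+1),
    [/\ uniq r, \sum_(a <- r) e a = 1,
        forall a b, a \in r -> b \in r -> a != b -> e a * e b = 0,
        forall a, GRing.comm X (e a) &
        forall a, a \in r -> e a != 0 /\ (X - a%:M) ^+ N * e a = 0].
Proof.
move=> Xs0; pose r := undup s; pose N := size s.
have ur : uniq r := undup_uniq s.
have horner0 p : (forall a, a \in r -> ('X - a%:P) ^+ N %| p) -> horner_mx X p = 0.
  move=> rp; have : \prod_(a <- s) ('X - a%:P) %| p.
    apply: dvdp_trans (prod_XsubC_dvd ur rp).
    rewrite -(big_undup_iterop_count *%R) /=.
    apply: (big_ind2 (fun u v : {poly E} => u %| v)) => // [u u' v v'|a _].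
      exact: dvdp_mul.
    by rewrite -[iterop _ _ _ _]/(_ ^+ _) dvdp_exp2l // count_size.
  by case/dvdpP=> q ->; rewrite rmorphM /= Xs0 mulr0.
have exp a : {p : {poly E} | forall b, b \in r -> ('X - b%:P) ^+ N %| p - (b == a)%:R%:P}.
  by have [q qP] := cid (poly_interpolation N (fun b => (b == a)%:R) ur); exists q.
pose p a := projT1 (exp a).
have pP a b : b \in r -> ('X - b%:P) ^+ N %| p a - (b == a)%:R%:P := projT2 (exp a) b.
have pP0 a b : b \in r -> b != a -> ('X - b%:P) ^+ N %| p a.
  by move=> br /negPf ba; have := pP a b br; rewrite ba subr0.
pose e a := horner_mx X (p a).
exists [seq a <- r | e a != 0], N, e; split.
- exact: filter_uniq.
- rewrite big_filter big_mkcond /=.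
  rewrite (eq_bigr e) => [|a _]; last by case: eqP.
  apply/eqP; rewrite -subr_eq0 -rmorph_sum -(rmorph1 (horner_mx X)) -rmorphB /=.
  apply/eqP/horner0 => b br; rewrite (bigD1_seq b) //= addrAC dvdp_add //.
    by have := pP b b br; rewrite eqxx.
  apply: (big_ind (fun q => _ %| q)) => // [|a ba]; first exact: dvdp_add.
  by rewrite pP0 // eq_sym.
- move=> a b; rewrite !mem_filter => /andP[_ ar] /andP[_ br] ab.
  rewrite -rmorphM /=; apply: horner0 => c cr.
  have [ca|ca] := eqVneq c a; last by rewrite dvdp_mulr ?pP0.
  by rewrite dvdp_mull ?pP0 // ca.
- by move=> a; apply/comm_mx_horner/comm_mx_refl.
move=> a; rewrite mem_filter => /andP[ea0 ar]; split=> //.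
have -> : (X - a%:M) = horner_mx X ('X - a%:P).
  by rewrite rmorphB /= horner_mx_X horner_mx_C.
rewrite -rmorphXn -rmorphM /=; apply: horner0 => c cr.
have [->|ca] := eqVneq c a; first exact: dvdp_mulr.
by rewrite dvdp_mull // pP0.
Qed.

End Decomposition.

(** * Polynomials in a linear endomorphism *)

Section LinearHorner.
Variables (E : fieldType) (V : lmodType E) (T : {linear V -> V}).
Implicit Types (p q : {poly E}) (z : V).

Definition lin_horner (p : {poly E}) (z : V) := \sum_(i < size p) p`_i *: iter i T z.

Lemma lin_horner_wide m p z : (size p <= m)%N ->
  lin_horner p z = \sum_(i < m) p`_i *: iter i T z.
Proof.
move=> le_p_m; rewrite /lin_horner (big_ord_widen m (fun i => p`_i *: iter i T z)) //.
rewrite big_mkcond; apply: eq_bigr => i _; case: ltnP => // le_p_i.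
by rewrite nth_default // scale0r.
Qed.

Lemma lin_hornerDl p q z : lin_horner (p + q) z = lin_horner p z + lin_horner q z.
Proof.
rewrite !(@lin_horner_wide (maxn (size p) (size q))) ?size_polyD ?leq_maxl ?leq_maxr //.
by rewrite -big_split; apply: eq_bigr => i _; rewrite coefD scalerDl.
Qed.

Lemma lin_hornerC c z : lin_horner c%:P z = c *: z.
Proof. by rewrite (@lin_horner_wide 1) ?size_polyC_leq1 // big_ord1 coefC. Qed.

Lemma lin_hornerZl c p z : lin_horner (c *: p) z = c *: lin_horner p z.
Proof.
rewrite (@lin_horner_wide (size p)) ?size_scale_leq // scaler_sumr.
by apply: eq_bigr => i _; rewrite coefZ scalerA.
Qed.

Lemma lin_horner_linear p : linear (lin_horner p).
Proof.
move=> a u v; rewrite /lin_horner scaler_sumr -big_split; apply: eq_bigr => i _ /=.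
by rewrite iter_linear scalerDr !scalerA mulrC.
Qed.

HB.instance Definition _ p :=
  GRing.isLinear.Build E V V _ (lin_horner p) (lin_horner_linear p).

Lemma lin_hornerMX p z : lin_horner (p * 'X) z = lin_horner p (T z).
Proof.
rewrite (@lin_horner_wide (size p).+1); last first.
  by apply: leq_trans (size_polyMleq _ _) _; rewrite size_polyX addn2.
rewrite big_ord_recl coefMX scale0r add0r; apply: eq_bigr => i _.
by rewrite coefMX /= -iterS iterSr.
Qed.

Lemma lin_horner_XsubC_exp p d N z :
  lin_horner (p * ('X - d%:P) ^+ N) z = lin_horner p (iter N (fun y => T y - d *: y) z).
Proof.
elim: N z => [|N IHN] z; first by rewrite mulr1.
rewrite iterSr -IHN exprSr mulrA; move: (p * _) => q.
by rewrite mulrBr mulrC [q * d%:P]mulrC mul_polyC -scaleNr mulrC lin_hornerDl lin_hornerMX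
  lin_hornerZl -linearZ -linearD scaleNr.
Qed.

(** On the generalized eigenspace of [T] at [d], a polynomial congruent to the
    constant [g] modulo a large power of ['X - d] acts as the scalar [g]. *)
Lemma lin_horner_eigen N d g p z :
    ('X - d%:P) ^+ N %| p - g%:P -> iter N (fun y => T y - d *: y) z = 0 ->
  lin_horner p z = g *: z.
Proof.
move=> /dvdpP[q /(canRL (subrK _))->] z0.
by rewrite lin_hornerDl lin_horner_XsubC_exp z0 linear0 add0r lin_hornerC.
Qed.
End LinearHorner.

(** * The trace argument for commutators *)

Section Commutator.
Variables (E : fieldType) (n : nat) (X : 'M[E]_n).

Definition mx_ad : {linear 'M[E]_n -> 'M[E]_n} := (mulmxr X \- mulmx X).

Lemma mx_adE z : mx_ad z = z *m X - X *m z. Proof. by []. Qed.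

(** On the block between the generalized eigenspaces at [b] and [c], the commutator
    with [X] is the sum of [c - b] and the difference of two commuting nilpotent
    multiplications, by [X - b] on the left and [X - c] on the right.  In an [N.*2]-th
    power of that difference, each term has one of the two at least [N] times. *)
Lemma mx_ad_nilpotent N b c (z : 'M[E]_n) :
    (X - b%:M) ^+ N * z = 0 -> z * (X - c%:M) ^+ N = 0 ->
  iter N.*2 (fun y => mx_ad y - (c - b) *: y) z = 0.
Proof.
move=> bz zc; pose D y := mx_ad y - (c - b) *: y.
have DE y : D y = y * (X - c%:M) - (X - b%:M) * y.
  rewrite /D mx_adE mulrBr mulrBl -!mulmxE mul_mx_scalar mul_scalar_mx scalerBl.
  by rewrite opprD addrACA -opprD.
have iterDB k : {morph iter k D : u v / u - v}.
  elim: k => // k IHk u v; rewrite !iterS IHk !DE.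
  rewrite [(_ - _) * (X - _)]mulrBl [(X - _) * (_ - _)]mulrBr.
  by rewrite opprD addrACA -opprD.
suff iterD0 k i j : (N.*2 <= i + j + k)%N ->
    iter k D ((X - b%:M) ^+ i * z * (X - c%:M) ^+ j) = 0.
  by have := iterD0 N.*2 0%N 0%N; rewrite !expr0 mul1r mulr1; apply.
elim: k i j => [|k IHk] i j; last first.
  move=> leN; rewrite iterSr DE iterDB -mulrA -exprSr !mulrA -exprS !IHk ?subrr //.
    by rewrite addSn addSnnS.
  by rewrite addnS addSnnS.
rewrite addn0 /= => leN; have [leNi | ltiN] := leqP N i.
  by rewrite -(subnK leNi) exprD -!mulrA (mulrA _ z) bz mul0r mulr0.
have leNj : (N <= j)%N.
  by rewrite -(leq_add2l N) addnn (leq_trans leN) // leq_add2r ltnW.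
by rewrite -(subnKC leNj) exprD -!mulrA (mulrA z) zc mul0r mulr0.
Qed.
End Commutator.

Section TraceOrthogonality.
Variables (E : fieldType) (n : nat) (X : 'M[E]_n.+1).
Variables (m N : nat) (a : 'I_m -> E) (e : 'I_m -> 'M[E]_n.+1).
Hypotheses (sum_e : \sum_i e i = 1) (eC : forall i, GRing.comm X (e i))
  (Xe : forall i, (X - (a i)%:M) ^+ N * e i = 0).
Variable w : 'I_m -> E.
Hypothesis w_additive : forall i j k l, a j - a i = a l - a k -> w j - w i = w l - w k.

(** Here [Y] is the weighted sum of the projections.  Its commutator with [v]
    multiplies the block [e i * v * e j] by [w j - w i], a function of the
    eigenvalue [a j - a i] of the commutator with [X] on that block.  By
    interpolation it is the value at [v] of a polynomial in the commutator with
    [X], and [tr ((u v - v u) Y) = tr (u (v Y - Y v))]. *)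
Lemma mxtrace_commutator_projections u v :
    (forall i, \tr (u *m iter i (mx_ad X) v) = 0) ->
  \tr ((u * v - v * u) * \sum_i w i *: e i) = 0.
Proof.
move=> trv.
(* The weight differences as a function of the eigenvalue differences. *)
pose G d := [set y | exists i j, d = a j - a i /\ y = w j - w i].
pose g d := xget 0 (G d).
have gE i j : g (a j - a i) = w j - w i.
  rewrite /g; have [|k [l [aE ->]]] := @xgetPex _ 0 (G (a j - a i)).
    by exists (w j - w i), i, j.
  exact: w_additive.
pose r := undup [seq a ij.2 - a ij.1 | ij : 'I_m * 'I_m].
have [P rP] := poly_interpolation N.*2 g (undup_uniq _ : uniq r).
pose Y := \sum_i w i *: e i.
have Pv : lin_horner (mx_ad X) P v = v * Y - Y * v.
  have vE : v = \sum_i \sum_j e i * v * e j.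
    under eq_bigr do rewrite -mulr_sumr sum_e mulr1.
    by rewrite -mulr_suml sum_e mul1r.
  rewrite {1}vE linear_sum /=.
  under eq_bigr => i _.
    rewrite linear_sum /=.
    under eq_bigr => j _.
      rewrite (@lin_horner_eigen _ _ _ N.*2 (a j - a i) (g (a j - a i))); first over.
        by apply: rP; rewrite mem_undup; apply/mapP; exists (i, j); rewrite ?mem_enum.
      apply: mx_ad_nilpotent; first by rewrite !mulrA Xe !mul0r.
      have /commrX eCN : GRing.comm (e j) (X - (a j)%:M).
        apply: commrB; first exact/commr_sym/eC.
        by apply: comm_mx_scalar.
      by rewrite -mulrA (eCN N) Xe mulr0.
    over.
  have -> : v * Y = \sum_i \sum_j w j *: (e i * v * e j).
    rewrite -[v in LHS]mul1r -sum_e !mulr_suml; apply: eq_bigr => i _.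
    by rewrite mulr_sumr; apply: eq_bigr => j _; rewrite scalerAr.
  have -> : Y * v = \sum_i \sum_j w i *: (e i * v * e j).
    rewrite -[v in LHS]mulr1 -sum_e mulrA !mulr_suml; apply: eq_bigr => i _.
    by rewrite mulr_sumr; apply: eq_bigr => j _; rewrite -!scalerAl.
  rewrite -sumrB; apply: eq_bigr => i _; rewrite -sumrB; apply: eq_bigr => j _.
  by rewrite gE scalerBl.
have trP : \tr (u *m lin_horner (mx_ad X) P v) = 0.
  rewrite /lin_horner mulmx_sumr raddf_sum big1 //= => i _.
  by rewrite -scalemxAr linearZ /= trv mulr0.
rewrite -/Y -[RHS]trP Pv mulrBl mulmxBr !linearB /= -!mulmxE !mulmxA.
by congr (_ - _); rewrite -mulmxA mxtrace_mulC.
Qed.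
End TraceOrthogonality.

(** * Rational relations between eigenvalues *)

Section RationalRelations.
Variable E : fieldType.
Hypothesis charE0 : [pchar E] =i pred0.

Lemma intr_pchar0_eq0 (z : int) : (z%:~R == 0 :> E) = (z == 0).
Proof.
have natE k : (k%:R == 0 :> E) = (k == 0)%N := (pcharf0P E).1 charE0 k.
by case: z => k; rewrite ?NegzE ?mulrNz ?oppr_eq0 -?pmulrn natE.
Qed.

(** In characteristic zero, [ratr] may be computed on any representation as a
    fraction, not only on the reduced one; its additivity and multiplicativity
    follow. *)
Lemma ratr_frac_pchar0 (p q : int) : q != 0 ->
  ratr (p%:~R / q%:~R) = p%:~R / q%:~R :> E.
Proof.
move=> q0; set x : rat := _ / _.
have xE : numq x * q = p * denq x.
  apply: (intr_inj (R := rat)); rewrite !intrM numqE mulrAC divfK //.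
  by rewrite intr_eq0.
rewrite /ratr; apply/eqP; rewrite eqr_div ?intr_pchar0_eq0 ?denq_eq0 //.
by rewrite -!intrM xE.
Qed.

Lemma ratrD_pchar0 : {morph (ratr : rat -> E) : x y / x + y}.
Proof.
move=> x y.
have dE (z : rat) : (denq z)%:~R != 0 :> E.
  by rewrite intr_pchar0_eq0 denq_eq0.
have dQ (z : rat) : (denq z)%:~R != 0 :> rat by rewrite intr_eq0 denq_eq0.
have -> : x + y = (numq x * denq y + numq y * denq x)%:~R / (denq x * denq y)%:~R.
  by rewrite -{1}(divq_num_den x) -{1}(divq_num_den y) addf_div // !(intrM, intrD).
rewrite ratr_frac_pchar0 ?mulf_neq0 ?denq_eq0 //.
by rewrite /ratr addf_div // !(intrM, intrD).
Qed.

Lemma ratrM_pchar0 : {morph (ratr : rat -> E) : x y / x * y}.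
Proof.
move=> x y; rewrite -{1}(divq_num_den x) -{1}(divq_num_den y) mulf_div -!intrM.
by rewrite ratr_frac_pchar0 ?mulf_neq0 ?denq_eq0 // /ratr mulf_div -!intrM.
Qed.

(** Let [rel] be the space of rational linear relations between the [a i].  A weight
    [w] orthogonal to [rel] is admissible in the hypothesis, which then says that
    the [k i * w i] form a relation.  Orthogonality gives that the sum of the
    [k i * w i ^+ 2] is zero, so [w = 0].  Hence [rel] is the whole space and each
    [a i] is zero. *)
Lemma rational_duality_eq0 m (a : 'I_m -> E) (k : 'I_m -> nat) :
    (forall i, 0 < k i)%N ->
    (forall w : 'I_m -> rat,
       (forall i j i' j', a j - a i = a j' - a i' -> w j - w i = w j' - w i') ->
       \sum_i ratr (w i) * (a i * (k i)%:R) = 0) ->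
  forall i, a i = 0.
Proof.
move=> k_gt0 trw.
pose rel (c : 'rV[rat]_m) := \sum_i ratr (c 0 i) * a i.
have relD c d : rel (c + d) = rel c + rel d.
  by rewrite -big_split; apply: eq_bigr => i _; rewrite mxE ratrD_pchar0 mulrDl.
have relZ q c : rel (q *: c) = ratr q * rel c.
  by rewrite mulr_sumr; apply: eq_bigr => i _; rewrite mxE ratrM_pchar0 mulrA.
have ratr0 : ratr 0 = 0 :> E by rewrite (ratr_int E 0).
have rel_delta i : rel (delta_mx 0 i) = a i.
  rewrite /rel (bigD1 i) //= big1 => [|j ji]; rewrite mxE ?eqxx /=.
    by rewrite (ratr_int E 1) mul1r addr0.
  by rewrite (negPf ji) ratr0 mul0r.
have relN c : rel (- c) = - rel c.
  by rewrite -scaleN1r relZ (ratr_int E (-1)) mulN1r.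
have [||T TP] := @subspace_row_space _ m [set c | rel c = 0].
- by rewrite /= /rel big1 // => i _; rewrite mxE ratr0 mul0r.
- by move=> q c d /= c0 d0; rewrite relD relZ c0 d0 mulr0 addr0.
(* The columns of [cokermx T] span the orthogonal of the space of relations. *)
suff cokT0 : cokermx T = 0.
  move=> i; rewrite -rel_delta; apply/TP.
  by rewrite submxE cokT0 mulmx0.
have Tcok c l : rel c = 0 -> \sum_i c 0 i * cokermx T i l = 0.
  move/TP; rewrite submxE => /eqP/(congr1 (fun A : 'rV_m => A 0 l)).
  by rewrite !mxE.
apply/matrixP => i l; pose w j := cokermx T j l.
have w_delta j : \sum_i (delta_mx 0 j : 'rV_m) 0 i * w i = w j.
  rewrite (bigD1 j) //= big1 => [|j' ji]; rewrite mxE ?eqxx ?mul1r ?addr0 //.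
  by rewrite (negPf ji) mul0r.
have sumk : \sum_j (k j)%:R * w j ^+ 2 = 0.
  have -> : \sum_j (k j)%:R * w j ^+ 2
          = \sum_j (\row_j ((k j)%:R * w j)) 0 j * cokermx T j l.
    by apply: eq_bigr => j _; rewrite mxE -mulrA -expr2.
  apply: (Tcok); rewrite -[RHS](trw w) => [|i1 j1 i2 j2 aE].
    by apply: eq_bigr => j _; rewrite mxE ratrM_pchar0 (ratr_nat E); ring.
  apply/eqP; rewrite -subr_eq0 -!w_delta -!sumrB; apply/eqP.
  rewrite -[RHS](Tcok (delta_mx 0 j1 - delta_mx 0 i1 - (delta_mx 0 j2 - delta_mx 0 i2)) l).
    by apply: eq_bigr => j _; rewrite -!mulrBl; congr (_ * _); rewrite !mxE.
  by rewrite !relD !relN !relD !relN !rel_delta aE subrr.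
have sq_ge0 j : 0 <= (k j)%:R * w j ^+ 2.
  by rewrite Num.Theory.mulr_ge0 ?Num.Theory.ler0n ?Num.Theory.sqr_ge0.
have /eqP := sumk; rewrite Num.Theory.psumr_eq0 // => /allP/(_ i (mem_index_enum _)) /=.
rewrite mulf_eq0 Num.Theory.pnatr_eq0 (gtn_eqF (k_gt0 i)) sqrf_eq0 => /eqP wi0.
by rewrite [RHS]mxE.
Qed.
End RationalRelations.

(** * Nilpotency from a vanishing trace form *)

(** [(X - a) e] is nilpotent, hence has trace zero. *)
Lemma mxtrace_mul_projection (E : fieldType) n (X e : 'M[E]_n) (a : E) N :
    e * e = e -> GRing.comm X e -> (X - a%:M) ^+ N * e = 0 ->
  \tr (X *m e) = a * (\rank e)%:R.
Proof.
move=> ee eC Xe; rewrite -(mxtrace_idempotent ee) -linearZ.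
apply/eqP; rewrite -subr_eq0 -linearB /= -mul_scalar_mx -mulmxBl; apply/eqP.
apply: (@mxtrace_nilpotent _ _ _ N.+1).
have XeC : GRing.comm (X - a%:M) e.
  by apply/commr_sym/commrB; [apply: commr_sym | apply: comm_mx_scalar].
rewrite mulmxE exprMn_comm // exprSr [e ^+ _]exprS mulrA -(mulrA (_ ^+ N)) XeC.
by rewrite mulrA Xe !mul0r.
Qed.

(** Extend the scalars to a field that splits the characteristic polynomial of [x].
    For a rational weight whose differences depend only on those of the
    eigenvalues, [tr (A Y)] is a linear function of [A] that vanishes on the
    commutators of [K], hence at [x].  Its value at [x] is the sum of the
    [w i * a i] times the multiplicities, and the duality between weights and
    rational relations gives that all eigenvalues are zero. *)
Theorem cartan_trace_nilpotent (F : fieldType) n (K : set 'M[F]_n) (x : 'M[F]_n) :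
    [pchar F] =i pred0 ->
    (forall u v, K u -> K v -> K (u * v - v * u)) ->
    (forall u v, K u -> K v -> \tr (u *m v) = 0) ->
    K x -> lspan [set u * v - v * u | u in K & v in K] x ->
  exists k, x ^+ k = 0.
Proof.
case: n => [|n] in K x *; first by exists 1%N; rewrite expr1 (flatmx0 x) (flatmx0 0).
move=> charF0 Kbr Ktr Kx Kx'.
have chi0 : char_poly x != 0 := monic_neq0 (char_poly_monic x).
have [E [f [s fs]]] := exists_splitting_field chi0.
have charE0 : [pchar E] =i pred0 by move=> p; rewrite (fmorph_pchar f) charF0.
pose X := map_mx f x.
have Xs0 : horner_mx X (\prod_(a <- s) ('X - a%:P)) = 0.
  have : map_poly f (char_poly x) %| \prod_(a <- s) ('X - a%:P).
    by rewrite (eqp_dvdl _ fs).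
  move=> /dvdpP[q ->]; rewrite rmorphM /= -map_horner_mx Cayley_Hamilton.
  by rewrite map_mx0 mulr0.
have [r [N [e [ur sum_e ortho_e eC Xe]]]] := spectral_projections Xs0.
pose a (i : 'I_(size r)) := nth 0 r i; pose e' i := e (a i).
have ar i : a i \in r by rewrite mem_nth.
have sum_e' : \sum_i e' i = 1 by rewrite -sum_e (big_nth 0) big_mkord.
have Xe' i : (X - (a i)%:M) ^+ N * e' i = 0 by case: (Xe _ (ar i)).
have idem_e' i : e' i * e' i = e' i.
  rewrite -[RHS]mulr1 -sum_e' mulr_sumr (bigD1 i) //= big1 ?addr0 // => j ji.
  by rewrite ortho_e // nth_uniq // eq_sym.
have a0 : forall i, a i = 0.
  apply: (@rational_duality_eq0 _ charE0 _ a (fun i => \rank (e' i))) => [i|w wadd].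
    by rewrite lt0n mxrank_eq0; case: (Xe _ (ar i)).
  pose w' i : E := ratr (w i).
  have w'add i j k l : a j - a i = a l - a k -> w' j - w' i = w' l - w' k.
    move=> /wadd wE; have ratrB (p q : rat) : ratr p - ratr q = ratr (p - q) :> E.
      by apply/eqP; rewrite subr_eq -ratrD_pchar0 // subrK.
    by rewrite !ratrB wE.
  pose Y := \sum_i w' i *: e' i.
  have : \tr (X *m Y) = 0.
    pose Z := [set A : 'M[F]_n.+1 | \tr (map_mx f A *m Y) = 0].
    apply: (Kx' Z); split.
      split=> [|c A B]; rewrite !inE /Z /=; first by rewrite map_mx0 mul0mx mxtrace0.
      move=> A0 B0; rewrite map_mxD map_mxZ mulmxDl -scalemxAl mxtraceD mxtraceZ A0 B0.
      by rewrite mulr0 addr0.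
    move=> _ [u Ku [v Kv <-]]; rewrite /Z /= map_mxB !map_mxM.
    apply: (mxtrace_commutator_projections sum_e' (fun i => eC _) Xe' w'add) => i.
    have -> : iter i (mx_ad X) (map_mx f v) = map_mx f (iter i (mx_ad x) v).
      by elim: i => //= i ->; rewrite map_mxB !map_mxM.
    have Kadv : K (iter i (mx_ad x) v).
      by elim: i => //= i Ki; apply: Kbr.
    by rewrite -map_mxM trace_map_mx Ktr // rmorph0.
  rewrite /Y mulmx_sumr raddf_sum /= => trXY.
  rewrite -[RHS]trXY; apply: eq_bigr => i _.
  rewrite -scalemxAr mxtraceZ; congr (_ * _).
  by rewrite (mxtrace_mul_projection (idem_e' i) (eC _) (Xe' i)).
exists N; apply: (map_mx_inj (f := f)); rewrite map_mx0 rmorphXn /=.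
rewrite -[LHS]mulr1 -sum_e' mulr_sumr big1 // => i _.
by have := Xe' i; rewrite a0 raddf0 subr0.
Qed.

(** * Finite-dimensional subspaces *)

Section Subspaces.
Variables (F : fieldType) (V : lmodType F).
Implicit Types (A B X : set V).

Lemma linear_subspaceP A :
  linear_subspace A <-> A 0 /\ forall a u v, A u -> A v -> A (a *: u + v).
Proof.
split=> [[A0 Alin]|[A0 Alin]]; split.
- by rewrite inE in A0.
- by move=> a u v Au Av; have := Alin a u v; rewrite !inE; apply.
- by rewrite inE.
- by move=> a u v; rewrite !inE; apply: Alin.
Qed.

Lemma sub_lspan X : X `<=` lspan X.
Proof. by move=> v Xv A [_]; apply. Qed.

Lemma lspan_min X A : linear_subspace A -> X `<=` A -> lspan X `<=` A.
Proof. by move=> lA XA v; apply. Qed.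

Lemma lspan_subspace X : linear_subspace (lspan X).
Proof.
apply/linear_subspaceP; split=> [A [/linear_subspaceP[]]//|a u v Xu Xv A XA].
have [/linear_subspaceP[_ Alin] _] := XA.
by apply: Alin; [apply: Xu | apply: Xv].
Qed.

Lemma lspanS X Y : X `<=` Y -> lspan X `<=` lspan Y.
Proof.
move=> XY; apply: lspan_min; first exact: lspan_subspace.
exact: subset_trans XY (@sub_lspan Y).
Qed.

Section Family.
Variables (n : nat) (e : 'I_n -> V).

Definition lincomb (c : 'rV[F]_n) : V := \sum_i c 0 i *: e i.

Lemma lincomb_is_linear : linear lincomb.
Proof.
move=> a u v; rewrite /lincomb scaler_sumr -big_split; apply: eq_bigr => i _.
by rewrite !mxE scalerDl scalerA.
Qed.

HB.instance Definition _ := GRing.isLinear.Build F 'rV[F]_n V _ lincomb lincomb_is_linear.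

Lemma lincomb_delta i : lincomb (delta_mx 0 i) = e i.
Proof.
rewrite /lincomb (bigD1 i) //= big1 => [|j ji]; rewrite mxE ?eqxx ?scale1r ?addr0 //.
by rewrite (negPf ji) scale0r.
Qed.

Lemma lincomb_sub A c : linear_subspace A -> (forall i, A (e i)) -> A (lincomb c).
Proof.
move=> /linear_subspaceP[A0 Alin] Ae; rewrite /lincomb.
by elim/big_rec: _ => // i v _; apply: Alin.
Qed.

Lemma lspan_range v : lspan (range e) v <-> exists c, v = lincomb c.
Proof.
split=> [|[c ->]]; last first.
  by apply: lincomb_sub => [|i]; [apply: lspan_subspace | apply: sub_lspan; exists i].
move: v; apply: lspan_min => [|_ [i _ <-]]; last first.
  by exists (delta_mx 0 i); rewrite lincomb_delta.
apply/linear_subspaceP; split=> [|a _ _ [c ->] [d ->]]; first by exists 0; rewrite linear0.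
by exists (a *: c + d); rewrite linearP.
Qed.
End Family.

Lemma lincomb_mulmx m n (e : 'I_n -> V) (P : 'M[F]_(m, n)) c :
  lincomb (fun i => lincomb e (row i P)) c = lincomb e (c *m P).
Proof. by rewrite mulmx_sum_row linear_sum; apply: eq_bigr => i _; rewrite linearZ. Qed.

Lemma finite_dim_range A :
  finite_dim A -> exists n (e : 'I_n -> V), A = lspan (range e).
Proof.
move=> [S /finite_seqP[s ->] ->]; exists (size s), (tnth (in_tuple s)).
congr lspan; apply/seteqP; split=> v /=; last by move=> [i _ <-]; apply: mem_tnth.
by move=> /(tnthP (in_tuple s))[i ->]; exists i.
Qed.

Lemma lspan_range_finite_dim n (e : 'I_n -> V) : finite_dim (lspan (range e)).
Proof. by exists (range e) => //; apply: finite_image. Qed.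

(** The coefficient vectors of the elements of [A] form the row space of a matrix,
    whose rows give generators of [A]. *)
Lemma finite_dim_subspace A B :
  linear_subspace A -> A `<=` B -> finite_dim B -> finite_dim A.
Proof.
move=> lA AB /finite_dim_range[n [e Be]].
have [A0 Alin] := (linear_subspaceP A).1 lA.
have [||T TP] := @subspace_row_space _ n [set c | A (lincomb e c)].
- by rewrite /= linear0.
- by move=> a u v /= Au Av; rewrite linearP; apply: Alin.
have -> : A = lspan (range (fun i => lincomb e (row i T))).
  apply/seteqP; split=> v.
    move=> Av; have := AB v Av; rewrite Be => /lspan_range[c vE].
    apply/lspan_range; move: Av; rewrite vE => /TP/submxP[d ->].
    by exists d; rewrite lincomb_mulmx.
  move: v; apply: lspan_min => // _ [i _ <-]; apply/TP; exact: row_sub.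
exact: lspan_range_finite_dim.
Qed.

(** Independent generators come from a complement, in the space of coefficient
    vectors, of the space of relations between the given generators. *)
Lemma finite_dim_basis A : finite_dim A ->
  exists n (e : 'I_n -> V), A = lspan (range e) /\ injective (lincomb e).
Proof.
move=> /finite_dim_range[n [e ->]].
have [||T TP] := @subspace_row_space _ n [set c | lincomb e c = 0].
- exact: linear0.
- by move=> a u v /= u0 v0; rewrite linearP /= u0 v0 scaler0 addr0.
pose C := row_base (T^C)%MS; exists _, (fun i => lincomb e (row i C)); split.
  apply/seteqP; split; last first.
    apply: lspan_min => [|_ [i _ <-]]; first exact: lspan_subspace.
    by apply/lspan_range; exists (row i C).
  move=> v /lspan_range[c ->]; apply/lspan_range.
  have /sub_addsmxP[[u1 u2] /= cE] : (c <= T + C)%MS.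
    apply: submx_full; rewrite /row_full (adds_eqmx (eqmx_refl T) (eq_row_base _)).
    exact: addsmx_compl_full.
  exists u2; rewrite lincomb_mulmx {1}cE linearD /=.
  by rewrite (_ : lincomb e (u1 *m T) = 0) ?add0r //; apply/TP; apply: submxMl.
move=> c d /eqP; rewrite -subr_eq0 -linearB /= lincomb_mulmx => /eqP/TP cdT.
apply/eqP; rewrite -subr_eq0 -(mulmx_free_eq0 _ (row_base_free (T^C)%MS)) -submx0.
rewrite -(capmx_compl T) sub_capmx cdT /=.
by apply: submx_trans (submxMl _ _) _; rewrite eq_row_base.
Qed.

End Subspaces.

(** * The trace modulo the Fitting null component *)

Section FittingTrace.
Variables (F : fieldType) (M : lmodType F) (T : {linear M -> M}).

Lemma iter_fixed0 k : iter k T 0 = 0.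
Proof. by elim: k => //= k ->; rewrite linear0. Qed.

Lemma fitting_nullP y : fitting_null T y <-> exists m, iter m T y = 0.
Proof.
split=> [[m _ ym]|[m ym]]; first by exists m.
by exists m.+1; rewrite //= ym linear0.
Qed.

Lemma iter_eq0_leq k m y : (k <= m)%N -> iter k T y = 0 -> iter m T y = 0.
Proof. by move=> /subnK <- yk; rewrite iterD yk iter_fixed0. Qed.

Lemma fitting_null_subspace : linear_subspace (fitting_null T).
Proof.
apply/linear_subspaceP; split=> [|a u v /fitting_nullP[k uk] /fitting_nullP[m vm]].
  by apply/fitting_nullP; exists 0%N.
apply/fitting_nullP; exists (maxn k m).
rewrite iter_linear (iter_eq0_leq (leq_maxl k m) uk) (iter_eq0_leq (leq_maxr k m) vm).
by rewrite scaler0 addr0.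
Qed.

Lemma fitting_null_stable y : fitting_null T y -> fitting_null T (T y).
Proof.
by move=> [m _ ym]; apply/fitting_nullP; exists m; rewrite -iterSr iterS ym linear0.
Qed.

Lemma fitting_null_sqr : fitting_null (T \; T) = fitting_null T.
Proof.
have iter_sqr m y : iter m (T \; T) y = iter m.*2 T y by elim: m => //= m ->.
apply/seteqP; split=> y.
  by move=> [m m0 ym]; apply/fitting_nullP; exists m.*2; rewrite -iter_sqr.
move=> [m m0 ym]; exists m => //; rewrite iter_sqr.
by apply: iter_eq0_leq ym; rewrite -addnn leq_addr.
Qed.

Local Notation N := (fitting_null T).

Lemma fitting_null_congr_trans u v w : N (u - v) -> N (v - w) -> N (u - w).
Proof.
have [_ Nlin] := (linear_subspaceP _).1 fitting_null_subspace.
by move=> uv vw; have := Nlin 1 _ _ uv vw; rewrite scale1r addrA subrK.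
Qed.

Lemma fitting_null_lincomb n (e f : 'I_n -> M) c :
  (forall i, N (e i - f i)) -> N (lincomb e c - lincomb f c).
Proof.
move=> ef; rewrite /lincomb -sumrB.
under eq_bigr do rewrite -scalerBr.
exact: (lincomb_sub c fitting_null_subspace ef).
Qed.

Section InvariantSubspace.
Variables (n : nat) (w : 'I_n -> M) (Q : 'M[F]_n).
Hypotheses (w_free : injective (lincomb w)) (wQ : forall i, T (w i) = lincomb w (row i Q))
  (w_full : forall v, exists c, N (v - lincomb w c)).

Lemma lincomb_invariant c k : iter k T (lincomb w c) = lincomb w (c *m Q ^+ k).
Proof.
elim: k => [|k IHk]; first by rewrite mulmx1.
rewrite iterS IHk exprSr -mulmxE mulmxA -[in RHS]lincomb_mulmx; move: (c *m _) => d.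
by rewrite linear_sum; apply: eq_bigr => i _; rewrite linearZ wQ.
Qed.

(** Let [C] and [D] be the matrices of the maps from the invariant subspace to the
    quotient by [N] and back, through chosen representatives.  Then [D *m C = 1]
    and [C] intertwines [Q] and [P], so [\tr P = \tr (Q *m C *m D)].  The remaining
    part of [\tr Q] is the trace of [Q *m Z], where [Z = 1 - C *m D] projects onto
    the intersection with [N]; there [T] is nilpotent. *)
Lemma mxtrace_induced r (e : 'I_r -> M) P :
  coset_basis N e -> induced_mx N T e P -> \tr P = \tr Q.
Proof.
move=> e_basis eP.
have e_uniq c d v : N (v - lincomb e c) -> N (v - lincomb e d) -> c = d.
  by have [x [_ x_uniq]] := e_basis v; move=> /x_uniq <- /x_uniq <-.
have e_full v : exists x, N (v - lincomb e x).
  by have [x [Nx _]] := e_basis v; exists x.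
have [c cP] := choice (fun i => w_full (e i)).
have [d dP] := choice (fun i => e_full (w i)).
pose C := \matrix_i d i; pose D := \matrix_i c i.
have eD i : N (e i - lincomb w (row i D)) by rewrite rowK.
have wC i : N (w i - lincomb e (row i C)) by rewrite rowK.
have N_eC v : N (lincomb w v - lincomb e (v *m C)).
  by rewrite -lincomb_mulmx; apply: fitting_null_lincomb.
have N_wD v : N (lincomb e v - lincomb w (v *m D)).
  by rewrite -lincomb_mulmx; apply: fitting_null_lincomb.
have N_eP v : N (T (lincomb e v) - lincomb e (v *m P)).
  rewrite -lincomb_mulmx (_ : T (lincomb e v) = lincomb (T \o e) v).
    apply: fitting_null_lincomb => i; have := eP i.
    rewrite (_ : \sum_j _ = lincomb e (row i P)) //.
    by apply: eq_bigr => j _; rewrite mxE.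
  by rewrite linear_sum; apply: eq_bigr => i _; rewrite linearZ.
have NT u v : N (u - v) -> N (T u - T v).
  by move=> /fitting_null_stable; rewrite linearB.
have DC : D *m C = 1%:M.
  apply/row_matrixP => i; rewrite row_mul row1; apply: (e_uniq _ _ (e i)).
    exact: fitting_null_congr_trans (eD i) (N_eC _).
  rewrite lincomb_delta subrr.
  by have [] := (linear_subspaceP _).1 fitting_null_subspace.
have QC : Q *m C = C *m P.
  apply/row_matrixP => i; rewrite !row_mul; apply: (e_uniq _ _ (T (w i))).
    by rewrite wQ; apply: N_eC.
  exact: fitting_null_congr_trans (NT _ _ (wC i)) (N_eP _).
pose Z := 1%:M - C *m D.
have ZC : Z *m C = 0 by rewrite mulmxBl mul1mx -mulmxA DC mulmx1 subrr.
have ZQZ : Z *m Q *m Z = Z *m Q.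
  rewrite {2}/Z mulmxBr mulmx1 mulmxA -(mulmxA Z) QC (mulmxA Z) ZC.
  by rewrite !mul0mx subr0.
have N_Z i : N (lincomb w (row i Z)).
  rewrite linearB /= linearB /= row1 lincomb_delta row_mul.
  exact: fitting_null_congr_trans (wC i) (N_wD _).
have [k kP] := choice (fun i => (fitting_nullP _).1 (N_Z i)).
pose K := (\max_i k i)%N.
have ZQK : Z *m Q ^+ K = 0.
  apply/row_matrixP => i; rewrite row_mul row0; apply: w_free.
  by rewrite -lincomb_invariant linear0 (iter_eq0_leq _ (kP i)) // leq_bigmax.
have trQZ : \tr (Q *m Z) = 0.
  apply: (@mxtrace_nilpotent _ _ _ K.+1); rewrite mulmx_expS.
  have ZQZk j : (Z *m Q) ^+ j *m Z = Z *m Q ^+ j.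
    elim: j => [|j IHj]; first by rewrite !expr0 mul1mx mulmx1.
    by rewrite exprS -mulmxE -mulmxA IHj mulmxA ZQZ exprS -mulmxE mulmxA.
  by rewrite -mulmxA ZQZk ZQK mulmx0.
move: trQZ; rewrite mulmxBr mulmx1 linearB /= => /eqP; rewrite subr_eq0 => /eqP ->.
by rewrite mulmxA QC mxtrace_mulC mulmxA DC mul1mx.
Qed.

(** The trace of [T] modulo its Fitting null component can be computed on any
    finite-dimensional invariant subspace that meets every coset. *)
Lemma fitting_trace_invariant : finite_codim N -> fitting_trace T = \tr Q.
Proof.
move=> [r [e e_basis]]; rewrite /fitting_trace.
set t := [set _ | _]; have : t !=set0.
  have e_full v : exists x, N (v - lincomb e x).
    by have [x [Nx _]] := e_basis v; exists x.
  have [P PP] := choice (fun i => e_full (T (e i))).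
  exists (\tr (\matrix_i P i)), r, e, (\matrix_i P i); split=> // i.
  rewrite (_ : \sum_j _ = lincomb e (P i)) //.
  by apply: eq_bigr => j _; rewrite mxE.
move=> /(@xgetPex _ 0)[r' [e' [P' [e'_basis e'P ->]]]].
exact: mxtrace_induced e'_basis e'P.
Qed.
End InvariantSubspace.
End FittingTrace.

(** * Derived series *)

Section DerivedSeries.
Variables (F : fieldType) (L : lieAlgType F).
Implicit Types A B H : set L.

Lemma lie_prodS A B A' B' : A `<=` A' -> B `<=` B' -> lie_prod A B `<=` lie_prod A' B'.
Proof.
move=> AA' BB'; apply: lspanS => _ [x Ax [y By <-]].
by exists x; [apply: AA' | exists y; [apply: BB' | ]].
Qed.

Lemma lie_prod_sub A H : lie_subalgebra H -> A `<=` H -> lie_prod A A `<=` H.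
Proof.
move=> [lH Hbr] AH; apply: lspan_min => // _ [x Ax [y Ay <-]].
by apply: Hbr; apply: AH.
Qed.

Lemma lie_derived_seriesS A B n :
  A `<=` B -> lie_derived_series A n `<=` lie_derived_series B n.
Proof. by move=> AB; elim: n => //= n IHn; apply: lie_prodS. Qed.

Lemma lie_derived_seriesD A m n :
  lie_derived_series (lie_derived_series A m) n = lie_derived_series A (n + m).
Proof. by elim: n => //= n ->. Qed.

Lemma lie_derived_series_subspace A n :
  linear_subspace A -> linear_subspace (lie_derived_series A n).
Proof. by case: n => //= n _; apply: lspan_subspace. Qed.

Lemma lie_derived_series_sub H n :
  lie_subalgebra H -> lie_derived_series H n `<=` H.
Proof. by move=> sH; elim: n => //= n; apply: lie_prod_sub. Qed.

Lemma lie_prod_subalgebra H :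
  lie_subalgebra H -> lie_subalgebra (lie_prod H H).
Proof.
move=> sH; split; first exact: lspan_subspace.
move=> x y Hx Hy; apply: sub_lspan; exists x; first exact: lie_prod_sub Hx.
by exists y => //; apply: lie_prod_sub Hy.
Qed.

End DerivedSeries.

(** * Matrices of a representation on an invariant subspace *)

Section RepresentationMatrix.
Variables (F : fieldType) (L : lieAlgType F) (M : lmodType F).
Variable rho : {linear L -> (M -> M)}.
Hypothesis rho_rep : lie_representation rho.
Variable H : set L.
Hypothesis H_sub : lie_subalgebra H.
Variables (n : nat) (w : 'I_n -> M).
Hypotheses (w_free : injective (lincomb w))
  (w_inv : forall x i, H x -> lspan (range w) (rho x (w i))).

(** Row [i] holds the coordinates of [rho x (w i)], so that matrices act on row
    vectors and products occur in the same order as those of transformations. *)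
Definition repmx (x : L) : 'M[F]_n :=
  \matrix_i xget 0 [set c | rho x (w i) = lincomb w c].

Lemma repmx_row x i : H x -> rho x (w i) = lincomb w (row i (repmx x)).
Proof.
move=> Hx; rewrite rowK; have /lspan_range[c cE] := w_inv i Hx.
exact: (@xgetI _ 0 [set c | rho x (w i) = lincomb w c] c cE).
Qed.

Lemma repmxE x c : H x -> rho x (lincomb w c) = lincomb w (c *m repmx x).
Proof.
move=> Hx; pose T := linear_map_of (rho_rep.1 x).
rewrite -lincomb_mulmx -[rho x]/(T : _ -> _) linear_sum; apply: eq_bigr => i _.
by rewrite linearZ /= -repmx_row.
Qed.

Lemma repmx_unique x A : H x ->
  (forall c, rho x (lincomb w c) = lincomb w (c *m A)) -> repmx x = A.
Proof.
move=> Hx xA; apply/row_matrixP => i; apply: w_free.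
by rewrite !rowE -repmxE.
Qed.

Lemma repmx_linear a x y : H x -> H y -> repmx (a *: x + y) = a *: repmx x + repmx y.
Proof.
move=> Hx Hy; apply: repmx_unique => [|c].
  by have [_] := (linear_subspaceP _).1 H_sub.1; apply.
have -> : rho (a *: x + y) = a *: rho x + rho y by rewrite linearP.
rewrite mulmxDr -scalemxAr linearP /= -!repmxE //.
Qed.

Lemma repmx_bracket x y : H x -> H y ->
  repmx (lie_bracket x y) = repmx x * repmx y - repmx y * repmx x.
Proof.
move=> Hx Hy; apply: repmx_unique => [|c]; first exact: H_sub.2.
by rewrite (rho_rep.2 x y) mulmxBr linearB /= -!mulmxE !mulmxA -!repmxE.
Qed.

Lemma repmx0 : repmx 0 = 0.
Proof.
have [H0 _] := (linear_subspaceP _).1 H_sub.1.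
by apply: repmx_unique => // c; rewrite (linear0 rho) mulmx0 linear0.
Qed.

Lemma repmx_preimage_subspace (Z : set 'M[F]_n) :
  linear_subspace Z -> linear_subspace [set x | H x /\ Z (repmx x)].
Proof.
have [H0 Hlin] := (linear_subspaceP _).1 H_sub.1.
move=> /linear_subspaceP[Z0 Zlin]; apply/linear_subspaceP; split=> /=.
  by rewrite repmx0.
move=> a x y [Hx Zx] [Hy Zy]; split; first exact: Hlin.
by rewrite repmx_linear //; apply: Zlin.
Qed.

(** Linear conditions on [repmx x] are inherited by the span of [X].  The
    restriction to [H] is needed since [repmx] is linear on [H] only. *)
Lemma lspan_repmx X (Z : set 'M[F]_n) : linear_subspace Z ->
  X `<=` H -> (forall x, X x -> Z (repmx x)) -> forall x, lspan X x -> Z (repmx x).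
Proof.
move=> lZ XH XZ x Xx.
suff [] : [set x | H x /\ Z (repmx x)] x by [].
apply: lspan_min Xx; first exact: repmx_preimage_subspace.
by move=> y Xy; split; [apply: XH | apply: XZ].
Qed.

Lemma mxtrace_ortho_subspace (A : 'M[F]_n) :
  linear_subspace [set B : 'M[F]_n | \tr (B *m A) = 0].
Proof.
apply/linear_subspaceP; split=> [|a B C] /=; first by rewrite mul0mx mxtrace0.
move=> B0 C0; rewrite mulmxDl -scalemxAl mxtraceD mxtraceZ B0 C0.
by rewrite mulr0 addr0.
Qed.

Lemma repmx_trace_form X :
    X `<=` H ->
    (forall x y, X x -> X y -> \tr (repmx x *m repmx y) = 0) ->
  forall x y, lspan X x -> lspan X y -> \tr (repmx x *m repmx y) = 0.
Proof.
move=> XH X0 x y Xx Xy.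
apply: (lspan_repmx (mxtrace_ortho_subspace (repmx y)) XH _ Xx) => z Xz /=.
rewrite mxtrace_mulC.
apply: (lspan_repmx (mxtrace_ortho_subspace (repmx z)) XH _ Xy) => t Xt /=.
exact: X0.
Qed.

Lemma repmx_derived_nilpotent x :
    [pchar F] =i pred0 ->
    (forall x y, H x -> H y -> \tr (repmx x *m repmx y) = 0) ->
  lie_prod H H x -> exists k, repmx x ^+ k = 0.
Proof.
move=> charF0 H0 H'x; have Hx : H x by apply: lie_prod_sub H'x.
apply: (@cartan_trace_nilpotent _ _ (repmx @` H)) => //.
- move=> _ _ [u Hu <-] [v Hv <-]; exists (lie_bracket u v); first exact: H_sub.2.
  exact: repmx_bracket.
- by move=> _ _ [u Hu <-] [v Hv <-]; apply: H0.
have XH : [set lie_bracket u v | u in H & v in H] `<=` H.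
  by move=> _ [u Hu [v Hv <-]]; apply: H_sub.2.
apply: (lspan_repmx (lspan_subspace _) XH _ H'x).
move=> _ [u Hu [v Hv <-]]; apply: sub_lspan.
exists (repmx u); first by exists u.
by exists (repmx v); [exists v | rewrite repmx_bracket].
Qed.

(** Each step of the derived series lengthens the words by at least one letter: a
    bracket [lie_bracket u z] of two elements of step [m] gives products of a letter
    in step [m], which descends the flag by [m + 1] steps, and a letter in [H],
    which descends it by one more. *)
Lemma repmx_derived_series k :
    words_vanish (repmx @` H) k ->
  forall x, lie_derived_series H k x -> repmx x = 0.
Proof.
move=> Hk x Hkx.
pose U := annihilated_by_words (repmx @` H).
suff U_series m j v y : lie_derived_series H m y -> U (j + m.+1)%N v ->
    U j (v * repmx y).
  rewrite -[LHS]mul1r; apply: (U_series k 0%N) => // t _.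
  exact: words_vanish_annihilated.
elim: m => [|m IHm] in j v y *; first by rewrite addn1 => Hy; apply; exists y.
move=> Hy Uv.
have lZ : linear_subspace [set A | U j (v * A)].
  apply/linear_subspaceP; split=> [|a A B] /=; first by rewrite mulr0; apply: annihilated0.
  by move=> UA UB; rewrite mulrDr -mulmxE -scalemxAr; apply: annihilated_lin.
pose D := lie_derived_series H m.
have XH : [set lie_bracket u z | u in D & z in D] `<=` H.
  move=> _ [u Hu [z Hz <-]]; apply: H_sub.2.
    exact: lie_derived_series_sub Hu.
  exact: lie_derived_series_sub Hz.
apply: (lspan_repmx lZ XH _ Hy).
move=> _ [u Hu [z Hz <-]].
have [H'u H'z] : H u /\ H z.
  by split; [apply: lie_derived_series_sub Hu | apply: lie_derived_series_sub Hz].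
have Uuz u' z' : lie_derived_series H m u' -> H z' -> U j (v * (repmx u' * repmx z')).
  move=> Hu' Hz'; rewrite mulrA.
  have : U j.+1 (v * repmx u') by apply: IHm => //; rewrite addSnnS.
  by apply; exists z'.
rewrite /= repmx_bracket // mulrBr addrC -scaleN1r.
by apply: annihilated_lin; apply: Uuz.
Qed.

End RepresentationMatrix.

(** * Finite-dimensional invariant subspaces *)

Section FiniteReduction.
Variables (F : fieldType) (L : lieAlgType F) (M : lmodType F).
Variable rho : {linear L -> (M -> M)}.
Hypothesis rho_rep : lie_representation rho.
Hypothesis rho_span : assoc_locally_finite (assoc_span rho).
Variable H : set L.
Hypothesis H_fin : finite_dim H.

(** The span of [s] and of its image under the finite-dimensional associative
    algebra that contains [rho x] for all [x] in [H].  That algebra need not contain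
    the identity, which is why [s] itself is included. *)
Lemma finite_invariant_subspace (s : seq M) :
  exists W : set M, [/\ finite_dim W, [set` s] `<=` W &
    forall x v, H x -> W v -> W (rho x v)].
Proof.
have [p [h HE]] := finite_dim_range H_fin.
have [||B [[[lB Bmul] Bfin] hB _]] := rho_span (S := range (rho \o h)).
- exact: finite_image.
- by move=> _ [i _ <-] A [_ rhoA]; apply: rhoA; exists (h i).
have HB x : H x -> B (rho x).
  rewrite HE => /lspan_range[c ->]; rewrite linear_sum /=.
  have [B0 Blin] := (linear_subspaceP _).1 lB.
  elim/big_rec: _ => // i A _ BA; rewrite linearZ; apply: Blin => //.
  by apply: hB; exists i.
have [q [b BE]] := finite_dim_range Bfin.
pose X := [set` s ++ [seq b i v | i <- enum 'I_q, v <- s]].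
have [W0 Wlin] := (linear_subspaceP _).1 (@lspan_subspace _ _ X).
have XB A v : B A -> v \in s -> lspan X (A v).
  rewrite BE => /lspan_range[c ->] sv.
  rewrite /lincomb fct_sumE; elim/big_rec: _ => // i u _; apply: Wlin.
  apply: sub_lspan; rewrite /X /= mem_cat; apply/orP; right.
  by apply/allpairsP; exists (i, v); rewrite mem_enum.
exists (lspan X); split.
- by exists X => //; apply: finite_seq.
- by move=> v sv; apply: sub_lspan; rewrite /X /= mem_cat sv.
move=> x v Hx; suff /(_ v) : lspan X `<=` [set v | lspan X (rho x v)] by [].
apply: lspan_min.
  apply/linear_subspaceP; split=> [|a u u'] /=.
    by have rx0 : rho x 0 = 0 := linear0 (linear_map_of (rho_rep.1 x)); rewrite rx0.
  by move=> Wu Wu'; rewrite (rho_rep.1 x); apply: Wlin.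
move=> u; rewrite /X /= mem_cat => /orP[su|/allpairsP[[i v'] /= [_ sv ->]]].
  by apply: XB => //; apply: HB.
apply: (XB (b i \; rho x)) => //; apply: Bmul; last exact: HB.
by rewrite BE; apply: sub_lspan; exists i.
Qed.

(** As long as some element of [H] kills [s] but does not act by zero, adding to [s]
    a vector that it moves makes the space of elements that kill [s] smaller. *)
Lemma finite_faithful_witness :
  exists s : seq M, forall x, H x -> (forall v, v \in s -> rho x v = 0) -> rho x = 0.
Proof.
have [p [h ->]] := finite_dim_range H_fin.
pose kills (s : seq M) := [set c | forall v, v \in s -> rho (lincomb h c) v = 0].
have kills_mx s : exists Z : 'M[F]_p, forall c, kills s c <-> (c <= Z)%MS.
  apply: subspace_row_space => [v _|a c d cs ds v sv]; first by rewrite !linear0.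
  have -> : rho (lincomb h (a *: c + d)) = a *: rho (lincomb h c) + rho (lincomb h d).
    by rewrite !linearP.
  by rewrite /= -[RHS](addr0 (0 : M)) -{1}(scaler0 M a) -{1}(cs v sv) -(ds v sv).
suff faithful k s (Z : 'M[F]_p) :
    (\rank Z < k)%N -> (forall c, kills s c <-> (c <= Z)%MS) ->
    exists s', forall c, kills s' c -> rho (lincomb h c) = 0.
  have [Z ZP] := kills_mx [::]; have [s sP] := faithful _ _ Z (ltnSn _) ZP.
  by exists s => _ /lspan_range[c ->]; apply: sP.
elim: k s Z => // k IHk s Z ltZk ZP.
have [sP|/existsNP[c /not_implyP[cs /eqP c_neq0]]] :=
    pselect (forall c, kills s c -> rho (lincomb h c) = 0); first by exists s.
have [v cv] : exists v, rho (lincomb h c) v <> 0.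
  apply: contrapT => c0; move/eqP: c_neq0; apply; apply/funext => v.
  by apply: contrapT => cv; apply: c0; exists v.
have [Z' Z'P] := kills_mx (v :: s); apply: (IHk (v :: s) Z') => //.
apply: (@leq_trans (\rank Z)); last by rewrite -ltnS.
apply: rank_ltmx; rewrite ltmxE; apply/andP; split.
  apply/rV_subP => d /Z'P dvs; apply/ZP => u su; apply: dvs.
  by rewrite inE su orbT.
apply/negP => ZZ'; apply: cv.
have /Z'P : (c <= Z')%MS by apply: submx_trans ZZ'; apply/ZP.
by apply; apply: mem_head.
Qed.
End FiniteReduction.

(** * From the trace condition to local solvability *)

Theorem theorem3 (F : fieldType) (charF0 : [pchar F] =i pred0)
    (L : lieAlgType F) (L_locfin : lie_locally_finite [set: L])
    (M : lmodType F) (rho : {linear L -> (M -> M)})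
    (rho_rep : lie_representation rho)
    (rho_codim : forall x : L, finite_codim (fitting_null (rho x)))
    (rho_span : assoc_locally_finite (assoc_span rho))
    (rho_ker : lie_locally_solvable (rep_kernel rho))
    (rho_tr : forall x : L, derived_algebra x ->
       fitting_trace (rho x \; rho x) = 0) :
  lie_locally_solvable [set: L].
Proof.
move=> S Sfin _; have [//|H [[Hsub Hfin] SH _]] := L_locfin S Sfin.
exists H; split=> //; split=> //.
set H1 := lie_derived_series H 1; set H2 := lie_derived_series H 2.
have H1_sub : lie_subalgebra H1 := lie_prod_subalgebra Hsub.
have H2_sub : lie_subalgebra H2 := lie_prod_subalgebra H1_sub.
have H1H : H1 `<=` H := lie_derived_series_sub Hsub (n := 1).
have H2H : H2 `<=` H := lie_derived_series_sub Hsub (n := 2).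
have H1L : H1 `<=` @derived_algebra F L by apply: lie_prodS.
have [p [g H1E]] := finite_dim_range (finite_dim_subspace H1_sub.1 H1H Hfin).
have [s0 faithful] := finite_faithful_witness rho Hfin.
have reps x : exists s : seq M, forall v, exists2 u, lspan [set` s] u &
    fitting_null (rho x) (v - u).
  have [r [e e_basis]] := rho_codim x; exists [seq e i | i <- enum 'I_r] => v.
  have [c [Nc _]] := e_basis v; exists (lincomb e c) => //.
  apply: lincomb_sub => [|i]; first exact: lspan_subspace.
  by apply: sub_lspan; rewrite /= map_f ?mem_enum.
have [rep repP] := choice reps.
(* By polarization, the trace form on [H1] is zero as soon as its quadratic form
   vanishes at these vectors. *)
pose xs := [seq g i | i <- enum 'I_p] ++ [seq g i + g j | i <- enum 'I_p, j <- enum 'I_p].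
have [W [Wfin sW Winv]] :=
  finite_invariant_subspace rho_rep rho_span Hfin (s0 ++ flatten [seq rep x | x <- xs]).
have [n [w [WE w_free]]] := finite_dim_basis Wfin.
have w_inv x i : H x -> lspan (range w) (rho x (w i)).
  by rewrite -WE => Hx; apply: Winv => //; rewrite WE; apply: sub_lspan; exists i.
have w_inv1 x i (H1x : H1 x) := w_inv x i (H1H x H1x).
have w_inv2 x i (H2x : H2 x) := w_inv x i (H2H x H2x).
pose R := repmx rho w.
have tr_xs x : x \in xs -> H1 x -> \tr (R x *m R x) = 0.
  move=> xxs H1x; have Hx := H1H x H1x.
  pose T := linear_map_of (rho_rep.1 x).
  pose T2 : {linear M -> M} := (T \o T).
  have T2E : fitting_null T2 = fitting_null T := fitting_null_sqr T.
  rewrite -[RHS](rho_tr x (H1L x H1x)); symmetry.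
  apply: (@fitting_trace_invariant _ _ T2 _ w) => //.
  - move=> i; rewrite [LHS]/= (repmx_row w_inv i Hx) (repmxE rho_rep w_inv _ Hx).
    by rewrite row_mul.
  - rewrite T2E => v; have [u us Nu] := repP x v.
    suff /lspan_range[c uE] : lspan (range w) u by exists c; rewrite -uE.
    rewrite -WE; apply: lspan_min us; first by rewrite WE; apply: lspan_subspace.
    move=> y /= ys; apply: sW; rewrite /= mem_cat; apply/orP; right.
    by apply/flattenP; exists (rep x) => //; apply: map_f.
  - by rewrite T2E; apply: rho_codim.
have H1g i : H1 (g i) by rewrite H1E; apply: sub_lspan; exists i.
have xs_g i : g i \in xs by rewrite mem_cat map_f ?mem_enum.
have xs_gg i j : g i + g j \in xs.
  by rewrite mem_cat; apply/orP; right; apply: allpairs_f; rewrite mem_enum.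
have two_neq0 : (2%:R : F) != 0 by rewrite ((pcharf0P F).1 charF0).
have RD x y : H x -> H y -> R (x + y) = R x + R y.
  move=> Hx Hy; have := repmx_linear rho_rep Hsub w_free w_inv 1 Hx Hy.
  by rewrite !scale1r.
have tr_gg i j : \tr (R (g i) *m R (g j)) = 0.
  have [_ H1lin] := (linear_subspaceP _).1 H1_sub.1.
  have H1gg : H1 (g i + g j) by rewrite -[g i]scale1r; apply: H1lin.
  have := tr_xs _ (xs_gg i j) H1gg; rewrite RD; try exact: H1H.
  rewrite mulmxDl !mulmxDr !mxtraceD !tr_xs // add0r addr0 [X in _ + X]mxtrace_mulC.
  by rewrite -mulr2n -mulr_natl => /eqP; rewrite mulf_eq0 (negPf two_neq0) => /eqP.
have tr_H1 x y : H1 x -> H1 y -> \tr (R x *m R y) = 0.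
  rewrite H1E; apply: (repmx_trace_form rho_rep Hsub w_free w_inv).
    by move=> _ [i _ <-]; apply: H1H.
  by move=> _ _ [i _ <-] [j _ <-]; apply: tr_gg.
have [||||k Hk] := @engel _ _ (R @` H2).
- exists 0; first by have [] := (linear_subspaceP _).1 H2_sub.1.
  exact: (repmx0 rho_rep H2_sub w_free w_inv2).
- move=> a _ _ [x Hx <-] [y Hy <-]; exists (a *: x + y).
    by have [_] := (linear_subspaceP _).1 H2_sub.1; apply.
  exact: (repmx_linear rho_rep H2_sub w_free w_inv2).
- move=> _ _ [x Hx <-] [y Hy <-]; exists (lie_bracket x y); first exact: H2_sub.2.
  exact: (repmx_bracket rho_rep H2_sub w_free w_inv2).
- move=> _ [x Hx <-].
  exact: (repmx_derived_nilpotent rho_rep H1_sub w_free w_inv1 charF0 tr_H1 Hx).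
pose C := lie_derived_series H (k + 2).
have CH : C `<=` H := lie_derived_series_sub Hsub (n := k + 2).
have Cker : C `<=` rep_kernel rho.
  move=> x Cx; apply: faithful => [|v vs]; first exact: CH.
  have /lspan_range[c ->] : lspan (range w) v.
    by rewrite -WE; apply: sW; rewrite /= mem_cat vs.
  rewrite (repmxE rho_rep w_inv _ (CH x Cx)) (_ : repmx rho w x = 0) ?mulmx0 ?linear0 //.
  apply: (repmx_derived_series rho_rep H2_sub w_free w_inv2 Hk).
  by rewrite lie_derived_seriesD.
have [X Xfin CX] : finite_dim C.
  by apply: finite_dim_subspace CH Hfin; apply: lie_derived_series_subspace Hsub.1.
have [|B [[Bsub [m Bm]] XB _]] := rho_ker X Xfin.
  by apply: subset_trans Cker; rewrite CX; apply: sub_lspan.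
have CB : C `<=` B by rewrite CX; apply: lspan_min XB; apply: Bsub.1.
exists (m + (k + 2))%N; rewrite -lie_derived_seriesD.
exact: subset_trans (lie_derived_seriesS (n := m) CB) Bm.
Qed.
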